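(* Let $\mu$ be a nontrivial probability measure on $\partial\mathbb{D}$ with $1\in\sigma_{\mathrm{ess}}(\mu)$, and for $t\ge0$ let $d\mu_t(\theta)=e^{2t\cos\theta}d\mu(\theta)/\int e^{2t\cos\theta}d\mu(\theta)$. Let $z_1^{(n)}(t),\dots,z_n^{(n)}(t)$ be the zeros of $\Phi_n(z;\mu_t)$. Then for all $n\ge1$ and $j=1,\dots,n$, $z_j^{(n)}(t)\to1$ as $t\to\infty$, and for all $n\ge0$, $\alpha_n(\mu_t)\to(-1)^n$ as $t\to\infty$.
   Context: Points of $\partial\mathbb{D}$ are written $e^{i\theta}$. A measure is nontrivial if its support is infinite. $\sigma_{\mathrm{ess}}(\mu)$ is the set of non-isolated points of $\mathrm{supp}\,\mu$. $\Phi_n(z;\nu)$ is the monic orthogonal polynomial of degree $n$ in $L^2(\nu)$, and $\alpha_n(\nu)=-\overline{\Phi_{n+1}(0;\nu)}$ are the Verblunsky coefficients (so that $\Phi_{n+1}(z)=z\Phi_n(z)-\overline{\alpha_n}z^n\overline{\Phi_n(1/\bar z)}$). The functions $\alpha_n(t)=\alpha_n(\mu_t)$ solve the Schur flow $\alpha_n'=(1-|\alpha_n|^2)(\alpha_{n+1}-\alpha_{n-1})$, $\alpha_{-1}\equiv-1$. *)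

(* Defs.v *)
From HB Require Import structures.
From mathcomp Require Import all_boot all_order all_algebra.
From mathcomp Require Import all_classical all_reals all_analysis.
From mathcomp Require Import complex.
Set Implicit Arguments.
Unset Strict Implicit.
Unset Printing Implicit Defensive.
Import Order.TTheory GRing.Theory Num.Theory.
Import numFieldNormedType.Exports.
Local Open Scope classical_set_scope.
Local Open Scope ring_scope.

Section OPUC.
Variable R : realType.

Definition expi (theta : R) : R[i] := (cos theta +i* sin theta)%C.

Definition cabs (z : R[i]) : R := Num.sqrt (complex.Re z ^+ 2 + complex.Im z ^+ 2).

(* complex integral  \int f(theta) w(theta) dmu(theta), computed on real and
   imaginary parts; for the bounded measurable integrands used below this is the
   usual Lebesgue integral of a complex function against the measure w dmu *)
Definition cint (mu : {measure set R -> \bar R}) (w : R -> R) (f : R -> R[i]) : R[i] :=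
  ((\int[mu]_x (w x * complex.Re (f x))) +i* (\int[mu]_x (w x * complex.Im (f x))))%C.

Definition cinner (mu : {measure set R -> \bar R}) (w : R -> R) (f g : R[i] -> R[i]) : R[i] :=
  cint mu w (fun theta => (f (expi theta))^*%C * g (expi theta)).

Definition is_monic_OP (mu : {measure set R -> \bar R}) (w : R -> R) (n : nat)
  (p : {poly R[i]}) : Prop :=
  [/\ p \is monic, size p = n.+1 &
      forall k : nat, (k < n)%N -> cinner mu w (fun z => z ^+ k) (fun z => p.[z]) = 0].

(* Phi_n(z; w dmu): the monic orthogonal polynomial of degree n in L^2(w dmu)
   (unique when w dmu is a nontrivial finite measure) *)
Definition Phi (mu : {measure set R -> \bar R}) (w : R -> R) (n : nat) : {poly R[i]} :=
  xget 0 (is_monic_OP mu w n).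

Definition alpha (mu : {measure set R -> \bar R}) (w : R -> R) (n : nat) : R[i] :=
  - ((Phi mu w n.+1).[0])^*%C.

(* support of mu, viewed as a measure on the circle via theta |-> e^{i theta} *)
Definition csupp (mu : {measure set R -> \bar R}) : set R[i] :=
  [set z | forall e : R, 0 < e -> (0 < mu [set theta | (cabs (expi theta - z) < e)%R])%E].

Definition nontrivial (mu : {measure set R -> \bar R}) : Prop := infinite_set (csupp mu).

Definition ess_supp (mu : {measure set R -> \bar R}) : set R[i] :=
  [set z | csupp mu z /\
     forall e : R, 0 < e -> exists2 y, csupp mu y & y != z /\ cabs (y - z) < e].

Definition wt (mu : {measure set R -> \bar R}) (t : R) (theta : R) : R :=
  expR (2 * t * cos theta) / (\int[mu]_x expR (2 * t * cos x)).

End OPUC.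

(* Main.v *)
Require Import Defs.
From HB Require Import structures.
From mathcomp Require Import all_boot all_order all_algebra.
From mathcomp Require Import all_classical all_reals all_analysis.
From mathcomp Require Import measurable_realfun complex ring lra.
Import Order.TTheory GRing.Theory Num.Theory.
Import numFieldNormedType.Exports.
Local Open Scope classical_set_scope.
Local Open Scope ring_scope.

(** Write w for the density of mu_t. If z is a zero of the monic orthogonal
    polynomial, then (X - z) q is orthogonal to q, so z - 1 is the mean of
    e^(i theta) - 1 for the probability density proportional to w |q|^2. It
    therefore suffices that w |q|^2 concentrates at 1 as t grows, uniformly
    over the nonzero q of degree less than n.

    Since 1 is not isolated in the support, arbitrarily close to 1 there are n
    well separated discs of positive measure. As q has fewer than n roots, one
    of the discs stays at distance at least r from all of them, and there |q|
    is, up to a factor depending only on n and r, at least the maximum of |q|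
    on the unit circle. The factor e^(2 t cos theta) then makes the mass of
    w |q|^2 away from 1 exponentially small compared with its mass on this disc.

    The same lower bound makes the Gram matrix of 1, X, X^2, ... invertible,
    so the orthogonal polynomials exist. The statement on alpha_n follows, since
    Phi_(n+1)(0) is the product of the n + 1 numbers - z_j. *)

(** * Modulus of complex numbers and products of numbers near 1 *)

Section ComplexModulus.
Variable R : realType.
Implicit Types (x y z : R[i]) (theta : R).

Lemma normc_cabs z : `|z| = (cabs z)%:C%C.
Proof. by rewrite normc_def. Qed.

Lemma cabs_ge0 z : 0 <= cabs z.
Proof. exact: sqrtr_ge0. Qed.

Lemma sqr_cabs z : cabs z ^+ 2 = complex.Re z ^+ 2 + complex.Im z ^+ 2.
Proof. by rewrite sqr_sqrtr// addr_ge0// sqr_ge0. Qed.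

Lemma cabsM x y : cabs (x * y) = cabs x * cabs y.
Proof. by apply: complexI; rewrite rmorphM /= -!normc_cabs normrM. Qed.

Lemma cabs_eq0 z : (cabs z == 0) = (z == 0).
Proof.
rewrite -[RHS]normr_eq0 normc_cabs.
by rewrite -[0 in RHS](rmorph0 (real_complex R)) (inj_eq (@complexI _)).
Qed.

Lemma cabs0 : cabs (0 : R[i]) = 0.
Proof. by apply/eqP; rewrite cabs_eq0. Qed.

Lemma cabs1 : cabs (1 : R[i]) = 1.
Proof. by apply: complexI; rewrite -normc_cabs normr1. Qed.

Lemma cabsN z : cabs (- z) = cabs z.
Proof. by apply: complexI; rewrite -!normc_cabs normrN. Qed.

Lemma cabsJ z : cabs z^*%C = cabs z.
Proof. by apply: complexI; rewrite -!normc_cabs normcJ. Qed.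

Lemma cabsX z n : cabs (z ^+ n) = cabs z ^+ n.
Proof. by elim: n => [|n IH]; rewrite ?expr0 ?cabs1// !exprS cabsM IH. Qed.

Lemma cabs_triangle x y : cabs (x + y) <= cabs x + cabs y.
Proof. by rewrite -lecR rmorphD /= -!normc_cabs ler_normD. Qed.

Lemma cabsC x y : cabs (x - y) = cabs (y - x).
Proof. by rewrite -cabsN opprB. Qed.

Lemma cabs_dist_triangle y x z : cabs (x - z) <= cabs (x - y) + cabs (y - z).
Proof. by rewrite (le_trans _ (cabs_triangle _ _))// addrA subrK. Qed.

Lemma normr_Re_le_cabs z : `|complex.Re z| <= cabs z.
Proof. by rewrite -sqrtr_sqr ler_wsqrtr// lerDl sqr_ge0. Qed.

Lemma normr_Im_le_cabs z : `|complex.Im z| <= cabs z.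
Proof. by rewrite -sqrtr_sqr ler_wsqrtr// lerDr sqr_ge0. Qed.

Lemma cabs_le_Re_Im z : cabs z <= `|complex.Re z| + `|complex.Im z|.
Proof.
rewrite -(@ler_pXn2r _ 2)// ?nnegrE ?cabs_ge0 ?addr_ge0//.
rewrite sqr_cabs sqrrD !real_normK ?num_real// lerD2r lerDl.
by rewrite mulrn_wge0// mulr_ge0.
Qed.

Lemma cabs_expi theta : cabs (expi theta) = 1.
Proof. by rewrite /cabs /= cos2Dsin2 sqrtr1. Qed.

(** Converts a distance from 1 on the circle into a value of [cos], hence into a bound on the
    exponential weight. *)
Lemma sqr_cabs_expi_sub1 theta :
  cabs (expi theta - 1) ^+ 2 = 2 - 2 * cos theta.
Proof. by rewrite sqr_cabs /=; have := cos2Dsin2 theta; lra. Qed.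

Lemma conjc_mul_self z : z^*%C * z = (cabs z ^+ 2)%:C%C.
Proof. by rewrite rmorphXn /= -normc_cabs sqr_normc mulrC. Qed.

(** Uniform in the list: [d] depends only on [m] and [e], so it can be fixed before the zeros, which
    move with t. *)
Lemma prod_near1 (m : nat) (e : R) : 0 < e ->
  exists2 d : R, 0 < d & forall s : seq R[i], size s = m ->
    (forall x, x \in s -> cabs (x - 1) < d) -> cabs (\prod_(x <- s) x - 1) < e.
Proof.
elim: m e => [|m IH] e e0.
  by exists 1 => // -[]// _ _; rewrite big_nil subrr cabs0.
(* The entry 1 in the minimum below gives |a| <= 2, so |ab - 1| <= 2 |b - 1| + |a - 1| < 2 e/4 +
   e/4. *)
have [|d d0 dP] := IH (e / 4); first lra.
exists (Num.min d (Num.min 1 (e / 4))).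
  by rewrite !lt_min d0; apply/and3P; split => //; lra.
move=> [//|a s] [sz] near1; rewrite big_cons.
have := near1 a (mem_head _ _); rewrite !lt_min => /and3P[_ a1 ae].
have {dP}be : cabs (\prod_(x <- s) x - 1) < e / 4.
  apply: dP => // x xs; have := near1 x; rewrite inE xs orbT lt_min.
  by move=> /(_ isT)/andP[].
set b := \prod_(x <- s) x in be *.
have -> : a * b - 1 = a * (b - 1) + (a - 1) by ring.
apply: le_lt_trans (cabs_triangle _ _) _; rewrite cabsM.
have a2 : cabs a <= 2.
  have := cabs_triangle (a - 1) 1; rewrite subrK cabs1; lra.
have : cabs a * cabs (b - 1) <= 2 * cabs (b - 1) by rewrite ler_wpM2r ?cabs_ge0.
by lra.
Qed.

End ComplexModulus.

(** * Polynomials on discs away from their roots *)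

Section SeparatedDiscs.
Variable R : realType.
Implicit Types (y z : R[i]) (s rs : seq R[i]) (q : {poly R[i]}) (r theta phi : R).

Lemma seq_positive_min (T : eqType) (s : seq T) (f : T -> R) :
  (forall x, x \in s -> 0 < f x) ->
  exists2 r : R, 0 < r & forall x, x \in s -> r <= f x.
Proof.
elim: s => [|a s IH] fs; first by exists 1.
have [|r r0 rs] := IH; first by move=> x xs; rewrite fs// inE xs orbT.
exists (Num.min r (f a)); first by rewrite lt_min r0 fs// mem_head.
by move=> x /predU1P[->|xs]; rewrite ge_min ?lexx ?orbT// rs.
Qed.

(** Pigeonhole: if every point of [s] had an entry of [rs] within 2r, choosing one would be
    injective, since two points sharing an entry are less than 4r apart. *)
Lemma exists_far_from_roots s rs r : uniq s -> (size rs < size s)%N ->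
  {in s &, forall y z, y != z -> 4 * r <= cabs (y - z)} ->
  exists2 y, y \in s & forall x, x \in rs -> 2 * r <= cabs (y - x).
Proof.
move=> us szs sep; apply: contrapT => H.
pose near y := [pred x | cabs (y - x) < 2 * r].
have hasn y : y \in s -> has (near y) rs.
  move=> ys; apply: contrapT => /negP/hasPn nh; apply: H; exists y => // x /nh /=.
  by rewrite -leNgt.
(* The default 0 is never read for [y] in [s]: [hasn] puts the index inside [rs]. *)
pose f y := nth 0 rs (find (near y) rs).
have fn y : y \in s -> cabs (y - f y) < 2 * r.
  by move=> /hasn /(nth_find 0).
suff : (size (map f s) <= size rs)%N by rewrite size_map leqNgt szs.
apply: uniq_leq_size.
  rewrite map_inj_in_uniq// => y z ys zs fyz; apply/eqP; apply: contrapT.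
  move=> /negP yz; have := sep _ _ ys zs yz.
  have := cabs_dist_triangle _ (f y) y z.
  have := fn _ ys; have := fn _ zs; rewrite -fyz (cabsC _ z); lra.
by move=> x /mapP[y ys ->]; rewrite mem_nth// -has_find hasn.
Qed.

(* A root at distance at least r from expi phi satisfies
   |expi theta - x| <= 2 + |expi phi - x| <= (1 + 2 / r) |expi phi - x|. *)
Lemma circle_comparison q rs y r theta phi : 0 < r ->
  q = lead_coef q *: \prod_(x <- rs) ('X - x%:P) ->
  (forall x, x \in rs -> 2 * r <= cabs (y - x)) ->
  cabs (expi phi - y) < r ->
  cabs q.[expi theta] <= (1 + 2 / r) ^+ size rs * cabs q.[expi phi].
Proof.
move=> r0 -> far near; rewrite !hornerZ !cabsM mulrCA ler_wpM2l ?cabs_ge0//.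
elim: rs far => [|x rs IH] far; first by rewrite !big_nil !hornerC expr0 mul1r.
rewrite !big_cons !hornerM !cabsM exprS mulrACA ler_pM ?cabs_ge0//; last first.
  by apply: IH => x' x's; apply: far; rewrite inE x's orbT.
rewrite !hornerXsubC.
have rx : r <= cabs (expi phi - x).
  have := far x (mem_head _ _).
  have := cabs_dist_triangle _ (expi phi) y x; rewrite (cabsC _ y (expi phi)); lra.
have t1 := cabs_dist_triangle _ (expi phi) (expi theta) x.
have : cabs (expi theta - expi phi) <= 2.
  by have := cabs_triangle _ (expi theta) (- expi phi); rewrite cabsN !cabs_expi.
have : 2 <= 2 / r * cabs (expi phi - x).
  by rewrite mulrAC ler_pdivlMr// ler_pM2l.
by rewrite mulrDl mul1r; lra.
Qed.

(** Only the choice of the disc depends on [q]; the constant does not, which is the source of all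
    later uniformity. No root lies in the disc, as its centre is at least 2r from each of them. *)
Lemma exists_disc_comparison s q r : 0 < r -> uniq s ->
  {in s &, forall y z, y != z -> 4 * r <= cabs (y - z)} ->
  q != 0 -> (size q <= size s)%N ->
  exists2 y, y \in s & forall theta phi, cabs (expi phi - y) < r ->
    cabs q.[expi theta] <= (1 + 2 / r) ^+ size s * cabs q.[expi phi]
    /\ q.[expi phi] != 0.
Proof.
move=> r0 us sep q0 szq; have [rs qE] := closed_field_poly_normal q.
have lc0 : lead_coef q != 0 by rewrite lead_coef_eq0.
(* The size of [q] is its number of roots plus one, hence the strict inequality. *)
have szrs : (size rs < size s)%N.
  by rewrite (leq_trans _ szq)// [in leqRHS]qE size_scale// size_prod_XsubC.
have [y ys far] := exists_far_from_roots s rs r us szrs sep.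
exists y => // theta phi near; split.
  apply: le_trans (circle_comparison q rs y r theta phi r0 qE far near) _.
  rewrite ler_wpM2r ?cabs_ge0// ler_weXn2l ?(ltnW szrs)//.
  by rewrite lerDl divr_ge0 ?ltW.
rewrite qE hornerZ mulf_neq0//; apply: contrapT => /negP; rewrite negbK => /eqP.
move=> /eqP; rewrite horner_prod prodf_seq_eq0 => /hasP[x xrs] /=.
rewrite hornerXsubC subr_eq0 => /eqP phix.
by have := far x xrs; rewrite -phix cabsC; lra.
Qed.

End SeparatedDiscs.

(** * Gram matrices of definite sesquilinear forms *)

Section GramMatrix.
Variable R : realType.
Variable B : {poly R[i]} -> {poly R[i]} -> R[i].
Hypothesis B_linearr : forall p a q r, B p (a *: q + r) = a * B p q + B p r.
Hypothesis B_conjl : forall p a q r, B (a *: q + r) p = a^*%C * B q p + B r p.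
Hypothesis B_definite : forall p, p != 0 -> B p p != 0.

Lemma form0r p : B p 0 = 0.
Proof.
have := B_linearr p 1 0 0; rewrite scaler0 addr0 mul1r.
by move/eqP; rewrite -subr_eq subrr => /eqP.
Qed.

Lemma form0l p : B 0 p = 0.
Proof.
have := B_conjl p 1 0 0; rewrite scaler0 addr0 conjc1 mul1r.
by move/eqP; rewrite -subr_eq subrr => /eqP.
Qed.

Lemma form_sumr p n (c : 'I_n -> R[i]) (q : 'I_n -> {poly R[i]}) :
  B p (\sum_i c i *: q i) = \sum_i c i * B p (q i).
Proof.
elim/big_rec2: _ => [|i x y _ <-]; first exact: form0r.
exact: B_linearr.
Qed.

Lemma form_suml p n (c : 'I_n -> R[i]) (q : 'I_n -> {poly R[i]}) :
  B (\sum_i c i *: q i) p = \sum_i (c i)^*%C * B (q i) p.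
Proof.
elim/big_rec2: _ => [|i x y _ <-]; first exact: form0l.
exact: B_conjl.
Qed.

(** The row index sits in the linear slot of [B], so a row vector of coefficients multiplies from
    the left without conjugation. *)
Definition gram n : 'M[R[i]]_n := \matrix_(i, j) B 'X^j 'X^i.

Lemma rVpoly_sum n (c : 'rV[R[i]]_n) : rVpoly c = \sum_i c 0 i *: 'X^i.
Proof.
rewrite /rVpoly poly_def; apply: eq_bigr => i _; congr (_ *: _).
by rewrite valK.
Qed.

Lemma mul_gram n (c : 'rV_n) j : (c *m gram n) 0 j = B 'X^j (rVpoly c).
Proof.
rewrite rVpoly_sum form_sumr mxE.
by apply: eq_bigr => i _; rewrite mxE.
Qed.

(** A row vector in the kernel is a polynomial orthogonal to every ['X^j] with j < n, hence to
    itself, so it vanishes by definiteness. *)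
Lemma gram_unit n : gram n \in unitmx.
Proof.
rewrite -row_free_unit; apply: inj_row_free => c cG.
apply/eqP; apply: contrapT => /negP c0.
have : rVpoly c != 0.
  apply: contra c0 => /eqP rc; by rewrite -(rVpolyK c) rc raddf0.
move=> /B_definite; rewrite {1}rVpoly_sum form_suml big1 ?eqxx// => j _.
by rewrite -mul_gram cG mxE mulr0.
Qed.

(** Correct ['X^n] by a polynomial of degree less than n; its coefficients solve a linear system
    whose matrix is the Gram matrix. *)
Lemma exists_monic_orthogonal n : exists p : {poly R[i]},
  [/\ p \is monic, size p = n.+1 & forall k, (k < n)%N -> B 'X^k p = 0].
Proof.
pose b := \row_(j < n) B 'X^j 'X^n.
pose c := - b *m invmx (gram n).
have szc : (size (rVpoly c) < size ('X^n : {poly R[i]}))%N.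
  by rewrite size_polyXn ltnS size_poly.
exists ('X^n + rVpoly c); split.
- by rewrite monicE lead_coefDl// lead_coefXn.
- by rewrite size_polyDl// size_polyXn.
move=> k kn; rewrite -['X^n]scale1r B_linearr mul1r.
have := mul_gram n c (Ordinal kn); rewrite mulmxKV ?gram_unit// !mxE /= => <-.
by rewrite subrr.
Qed.

End GramMatrix.

(** * Integrals of bounded measurable functions *)

Section BoundedMeasurable.
Variables (R : realType) (mu : probability R R).
Implicit Types (f g h w : R -> R).

(** Unlike integrability, this is stable under products; it implies integrability because [mu] is
    finite. *)
Definition bounded_measurable h :=
  measurable_fun [set: R] h /\ exists M : R, forall x, `|h x| <= M.

Lemma bounded_measurable_integrable h :
  bounded_measurable h -> mu.-integrable [set: R] (EFin \o h).
Proof.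
move=> [mh [M hM]]; apply: measurable_bounded_integrable => //.
  by rewrite -ge0_fin_numE// fin_num_measure.
exists M; split; first exact: num_real.
by move=> M' MM' x _ /=; rewrite (le_trans (hM x))// ltW.
Qed.

Lemma bounded_measurable_cst (c : R) : bounded_measurable (fun=> c).
Proof. by split; [exact: measurable_cst|exists `|c|]. Qed.

Lemma bounded_measurableD f g : bounded_measurable f -> bounded_measurable g ->
  bounded_measurable (fun x => f x + g x).
Proof.
move=> [mf [M fM]] [mg [N gN]]; split; first exact: measurable_funD.
by exists (M + N) => x; rewrite (le_trans (ler_normD _ _))// lerD.
Qed.

Lemma bounded_measurableM f g : bounded_measurable f -> bounded_measurable g ->
  bounded_measurable (fun x => f x * g x).
Proof.
move=> [mf [M fM]] [mg [N gN]]; split; first exact: measurable_funM.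
by exists (M * N) => x; rewrite normrM ler_pM.
Qed.

Lemma bounded_measurableN f :
  bounded_measurable f -> bounded_measurable (fun x => - f x).
Proof.
move=> /(bounded_measurableM _ _ (bounded_measurable_cst (- 1))).
by under eq_fun do rewrite mulN1r.
Qed.

Lemma bounded_measurable_cos : bounded_measurable cos.
Proof.
split; last by exists 1 => x; exact: cos_max.
by apply: continuous_measurable_fun; exact: continuous_cos.
Qed.

Lemma bounded_measurable_sin : bounded_measurable sin.
Proof.
split; last by exists 1 => x; exact: sin_max.
by apply: continuous_measurable_fun; exact: continuous_sin.
Qed.

Lemma bounded_measurable_expR h :
  bounded_measurable h -> bounded_measurable (fun x => expR (h x)).
Proof.
move=> [mh [M hM]]; split; first by apply: measurableT_comp mh.
exists (expR M) => x; rewrite ger0_norm ?expR_ge0// ler_expR.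
by rewrite (le_trans (ler_norm _)).
Qed.

Lemma le_Rintegral_bounded f g : bounded_measurable f -> bounded_measurable g ->
  (forall x, f x <= g x) -> \int[mu]_x f x <= \int[mu]_x g x.
Proof.
by move=> bf bg fg; apply: le_Rintegral => //; exact: bounded_measurable_integrable.
Qed.

Lemma RintegralD_bounded f g : bounded_measurable f -> bounded_measurable g ->
  \int[mu]_x (f x + g x) = \int[mu]_x f x + \int[mu]_x g x.
Proof.
by move=> bf bg; apply: RintegralD => //; exact: bounded_measurable_integrable.
Qed.

Lemma RintegralZ_bounded (c : R) f : bounded_measurable f ->
  \int[mu]_x (c * f x) = c * \int[mu]_x f x.
Proof.
by move=> bf; apply: RintegralZl => //; exact: bounded_measurable_integrable.
Qed.

Lemma Rintegral_probability_cst (c : R) : \int[mu]_x c = c.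
Proof.
have mu1 : fine (mu [set: R]) = 1 by rewrite probability_setT.
by rewrite Rintegral_cst//; exact: etrans (congr1 _ mu1) (mulr1 c).
Qed.

Lemma normr_Rintegral_le f g : bounded_measurable f -> bounded_measurable g ->
  (forall x, `|f x| <= g x) -> `|\int[mu]_x f x| <= \int[mu]_x g x.
Proof.
move=> bf bg fg; rewrite ler_norml; apply/andP; split; last first.
  by apply: le_Rintegral_bounded => // x; rewrite (le_trans (ler_norm _)).
rewrite -mulN1r -RintegralZ_bounded//; apply: le_Rintegral_bounded => //.
  exact: (bounded_measurableM _ _ (bounded_measurable_cst (- 1))).
by move=> x; rewrite mulN1r lerNl (le_trans _ (fg x))// -normrN ler_norm.
Qed.

(** Markov's inequality: [h] dominates c times the indicator of [D]. *)
Lemma measure_le_Rintegral h (D : set R) (c : R) : bounded_measurable h ->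
  measurable D -> (forall x, 0 <= h x) -> (forall x, D x -> c <= h x) ->
  c * fine (mu D) <= \int[mu]_x h x.
Proof.
move=> bh mD h0 hc.
have bD : bounded_measurable (\1_D : R -> R).
  split; first exact: measurable_indic.
  by exists 1 => x; rewrite indicE; case: (_ \in _); rewrite ?normr1 ?normr0.
have -> : fine (mu D) = \int[mu]_x (\1_D x : R).
  by rewrite /Rintegral integral_indic// setIT.
rewrite -RintegralZ_bounded//; apply: le_Rintegral_bounded => //.
  exact: (bounded_measurableM _ _ (bounded_measurable_cst _)).
move=> x; rewrite indicE; case: (boolP (x \in D)) => [/set_mem/hc|_].
  by rewrite mulr1.
by rewrite mulr0.
Qed.

End BoundedMeasurable.

(** * Weighted complex integrals and the inner product of polynomials *)

Section ComplexIntegral.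
Variables (R : realType) (mu : probability R R) (w : R -> R).
Hypothesis bw : bounded_measurable R w.
Implicit Types (f g : R -> R[i]) (p q r : {poly R[i]}).

Definition cbounded_measurable f :=
  bounded_measurable R (fun x => complex.Re (f x)) /\
  bounded_measurable R (fun x => complex.Im (f x)).

Lemma cbounded_measurable_cst (c : R[i]) : cbounded_measurable (fun=> c).
Proof. by split; exact: bounded_measurable_cst. Qed.

Lemma cbounded_measurable_expi : cbounded_measurable (@expi R).
Proof.
by split; [exact: bounded_measurable_cos|exact: bounded_measurable_sin].
Qed.

Lemma ReD (x y : R[i]) : complex.Re (x + y) = complex.Re x + complex.Re y.
Proof. by case: x; case: y. Qed.

Lemma ImD (x y : R[i]) : complex.Im (x + y) = complex.Im x + complex.Im y.
Proof. by case: x; case: y. Qed.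

Lemma ReM (x y : R[i]) : complex.Re (x * y) =
  complex.Re x * complex.Re y - complex.Im x * complex.Im y.
Proof. by case: x; case: y. Qed.

Lemma ImM (x y : R[i]) : complex.Im (x * y) =
  complex.Re x * complex.Im y + complex.Im x * complex.Re y.
Proof. by case: x; case: y. Qed.

Lemma cbounded_measurableD f g :
  cbounded_measurable f -> cbounded_measurable g ->
  cbounded_measurable (fun x => f x + g x).
Proof.
move=> [rf jf] [rg jg]; split.
- by under eq_fun do rewrite ReD; exact: bounded_measurableD.
- by under eq_fun do rewrite ImD; exact: bounded_measurableD.
Qed.

Lemma cbounded_measurableM f g :
  cbounded_measurable f -> cbounded_measurable g ->
  cbounded_measurable (fun x => f x * g x).
Proof.
move=> [rf jf] [rg jg]; split.
- under eq_fun do rewrite ReM; apply: bounded_measurableD.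
    exact: bounded_measurableM.
  by apply: bounded_measurableN; exact: bounded_measurableM.
- under eq_fun do rewrite ImM; apply: bounded_measurableD;
    exact: bounded_measurableM.
Qed.

Lemma cbounded_measurableJ f :
  cbounded_measurable f -> cbounded_measurable (fun x => (f x)^*%C).
Proof.
move=> [rf jf]; split.
- by apply: eq_ind rf _ _; apply/funext => x; case: (f x).
- have := bounded_measurableN _ _ jf; congr (bounded_measurable _ _).
  by apply/funext => x; case: (f x).
Qed.

Lemma cbounded_measurable_horner p :
  cbounded_measurable (fun x => p.[expi x]).
Proof.
elim/poly_ind: p => [|p c IH].
  by under eq_fun do rewrite horner0; exact: cbounded_measurable_cst.
under eq_fun do rewrite hornerMXaddC.
apply: cbounded_measurableD; last exact: cbounded_measurable_cst.
by apply: cbounded_measurableM => //; exact: cbounded_measurable_expi.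
Qed.

Lemma cbounded_measurable_conj_mul p q :
  cbounded_measurable (fun x => (p.[expi x])^*%C * q.[expi x]).
Proof.
apply: cbounded_measurableM; last exact: cbounded_measurable_horner.
exact/cbounded_measurableJ/cbounded_measurable_horner.
Qed.

Lemma bounded_measurable_sqr_cabs q :
  bounded_measurable R (fun x => cabs q.[expi x] ^+ 2).
Proof.
have [rq jq] := cbounded_measurable_horner q.
under eq_fun do rewrite sqr_cabs !expr2.
by apply: bounded_measurableD; exact: bounded_measurableM.
Qed.

Lemma cintD f g : cbounded_measurable f -> cbounded_measurable g ->
  cint mu w (fun x => f x + g x) = cint mu w f + cint mu w g.
Proof.
move=> [rf jf] [rg jg]; rewrite /cint.
under eq_Rintegral do rewrite ReD mulrDr.
under [X in (_ +i* X)%C]eq_Rintegral do rewrite ImD mulrDr.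
by rewrite !RintegralD_bounded//; exact: bounded_measurableM.
Qed.

Lemma cintZ (a : R[i]) f : cbounded_measurable f ->
  cint mu w (fun x => a * f x) = a * cint mu w f.
Proof.
move=> [rf jf]; rewrite /cint.
have wrf := bounded_measurableM _ _ _ bw rf.
have wjf := bounded_measurableM _ _ _ bw jf.
have bZ (c : R) h : bounded_measurable R h -> bounded_measurable R (fun x => c * h x).
  by move=> bh; apply: bounded_measurableM => //; exact: bounded_measurable_cst.
case: a => a b; congr Complex.
- under eq_Rintegral => x _.
    rewrite ReM /= mulrBr mulrCA -[X in _ - X]mulrCA -mulNr.
    over.
  rewrite RintegralD_bounded; [|exact: bZ..].
  by rewrite !RintegralZ_bounded// mulNr.
- under eq_Rintegral => x _.
    rewrite ImM /= mulrDr mulrCA [X in _ + X]mulrCA.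
    over.
  rewrite RintegralD_bounded; [|exact: bZ..].
  by rewrite !RintegralZ_bounded.
Qed.

(** The factor 2 comes from estimating the real and imaginary parts separately. *)
Lemma cabs_cint_le f (g : R -> R) : cbounded_measurable f -> bounded_measurable R g ->
  (forall x, 0 <= w x) -> (forall x, w x * cabs (f x) <= g x) ->
  cabs (cint mu w f) <= 2 * \int[mu]_x g x.
Proof.
move=> [rf jf] bg w0 fg; apply: le_trans (cabs_le_Re_Im _ _) _.
rewrite mulr_natl mulr2n lerD//; apply: normr_Rintegral_le => //;
  do ?[exact: bounded_measurableM]; move=> x; rewrite normrM ger0_norm//;
  apply: le_trans (fg x); rewrite ler_wpM2l//.
- exact: normr_Re_le_cabs.
- exact: normr_Im_le_cabs.
Qed.

Definition poly_form p q := cinner mu w (horner p) (horner q).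

Lemma poly_form_linearr p (a : R[i]) q r :
  poly_form p (a *: q + r) = a * poly_form p q + poly_form p r.
Proof.
rewrite /poly_form /cinner -cintZ -?cintD; do ?exact: cbounded_measurable_conj_mul.
- by congr (cint _ _ _); apply/funext => x; rewrite hornerD hornerZ mulrDr mulrCA.
- apply: cbounded_measurableM; first exact: cbounded_measurable_cst.
  exact: cbounded_measurable_conj_mul.
Qed.

Lemma poly_form_conjl p (a : R[i]) q r :
  poly_form (a *: q + r) p = a^*%C * poly_form q p + poly_form r p.
Proof.
rewrite /poly_form /cinner -cintZ -?cintD; do ?exact: cbounded_measurable_conj_mul.
- congr (cint _ _ _); apply/funext => x.
  by rewrite hornerD hornerZ rmorphD rmorphM /= mulrDl mulrA.
- apply: cbounded_measurableM; first exact: cbounded_measurable_cst.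
  exact: cbounded_measurable_conj_mul.
Qed.

Lemma poly_form_self q :
  poly_form q q = (\int[mu]_x (w x * cabs q.[expi x] ^+ 2))%:C%C.
Proof.
rewrite /poly_form /cinner /cint; congr Complex.
  by apply: eq_Rintegral => x _; rewrite conjc_mul_self.
under eq_Rintegral do rewrite conjc_mul_self /= mulr0.
by rewrite Rintegral_probability_cst.
Qed.

Lemma poly_form_OP n p q : is_monic_OP mu w n p -> (size q <= n)%N ->
  poly_form q p = 0.
Proof.
move=> [_ _ orth] szq; rewrite -[q]coefK poly_def.
rewrite (form_suml _ _ (poly_form_conjl)) big1// => i _.
have := orth i (leq_trans (ltn_ord i) szq).
rewrite /poly_form (_ : horner 'X^i = (fun z => z ^+ i)) => [->|].
  by rewrite mulr0.
by apply/funext => z; rewrite hornerXn.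
Qed.

(** Positivity makes the form definite, so an orthogonal polynomial exists and [xget] does not fall
    back on its default 0. *)
Lemma is_monic_OP_Phi n :
  (forall q, q != 0 -> 0 < \int[mu]_x (w x * cabs q.[expi x] ^+ 2)) ->
  is_monic_OP mu w n (Phi mu w n).
Proof.
move=> pos; rewrite /Phi; case: xgetP => [p _ //|noOP].
have [||p|p [monp szp orth]] := exists_monic_orthogonal R poly_form _ _ _ n.
- exact: poly_form_linearr.
- exact: poly_form_conjl.
- by move=> /pos p0; rewrite poly_form_self -(rmorph0 (real_complex R))
    (inj_eq (@complexI _)) gt_eqF.
exfalso; apply: (noOP p); split => // k /orth <-.
by congr (cinner _ _ _ _); apply/funext => z; rewrite hornerXn.
Qed.

(* If p = (X - z) q is orthogonal to q, then z is the mean of expi under the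
   probability density proportional to w |q|^2. *)
Lemma root_OP n p z : is_monic_OP mu w n p -> root p z ->
  exists2 q : {poly R[i]}, q != 0 /\ size q = n &
    (z - 1) * poly_form q q =
    cint mu w (fun x => (expi x - 1) * ((q.[expi x])^*%C * q.[expi x])).
Proof.
move=> OPp /factor_theorem[q pE]; have [monp szp _] := OPp.
have p0 : p != 0 by rewrite monic_neq0.
have q0 : q != 0 by apply: contraNneq p0 => q0; rewrite pE q0 mul0r.
have szq : size q = n.
  by apply/succn_inj; rewrite -szp pE size_Mmonic ?monicXsubC// size_XsubC addn2.
exists q => //; have := poly_form_OP n p q OPp; rewrite szq leqnn => /(_ isT).
(* Splitting X - z as (1 - z) + (X - 1) centres the mean at 1; pairing with [q] then gives zero. *)
have -> : p = (1 - z) *: q + ('X - 1%:P) * q.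
  by rewrite pE -mul_polyC polyCB; ring.
rewrite poly_form_linearr => /eqP; rewrite addrC addr_eq0 -mulNr opprB => /eqP <-.
congr (cint _ _ _); apply/funext => x; rewrite hornerM hornerXsubC mulrCA; ring.
Qed.

End ComplexIntegral.

(** * Concentration at 1, zeros and Verblunsky coefficients *)

Section Concentration.
Variables (R : realType) (mu : probability R R).
Implicit Types (y z : R[i]) (q : {poly R[i]}) (r t theta : R).

Lemma measurable_disc y r : measurable [set theta | cabs (expi theta - y) < r].
Proof.
have mc : measurable_fun [set: R] (fun x : R => cabs (expi x - y)).
  have -> : (fun x : R => cabs (expi x - y)) =
      Num.sqrt \o (fun x => cabs ('X - y%:P).[expi x] ^+ 2).
    by apply/funext => x /=; rewrite sqrtr_sqr ger0_norm ?cabs_ge0// hornerXsubC.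
  apply: measurableT_comp.
    by apply: continuous_measurable_fun; exact: sqrt_continuous.
  by have [] := bounded_measurable_sqr_cabs R ('X - y%:P).
rewrite -[X in measurable X]setTI (_ : [set _ | _] =
  (fun x : R => cabs (expi x - y)) @^-1` `]-oo, r[%classic); first exact: mc.
by apply/seteqP; split => x /=; rewrite in_itv.
Qed.

Lemma measure_gt0_nonempty (D : set R) : 0 < fine (mu D) -> D !=set0.
Proof.
by move=> D0; apply/set0P; apply: contraTneq D0 => ->; rewrite measure0 ltxx.
Qed.

Lemma bounded_measurable_expcos t :
  bounded_measurable R (fun x => expR (2 * t * cos x)).
Proof.
apply: bounded_measurable_expR; apply: bounded_measurableM.
  exact: bounded_measurable_cst.
exact: bounded_measurable_cos.
Qed.

Lemma expcos_ge t (x : R) : expR (- `|2 * t|) <= expR (2 * t * cos x).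
Proof.
rewrite ler_expR lerNl -mulrN (le_trans (ler_norm _))// normrM normrN.
by rewrite ler_piMr// cos_max.
Qed.

Lemma Rintegral_expcos_gt0 t : 0 < \int[mu]_x expR (2 * t * cos x).
Proof.
apply: (@lt_le_trans _ _ (expR (- `|2 * t|))); first exact: expR_gt0.
rewrite -[leLHS](Rintegral_probability_cst _ mu).
apply: le_Rintegral_bounded; first exact: bounded_measurable_cst.
  exact: bounded_measurable_expcos.
exact: expcos_ge.
Qed.

Lemma bounded_measurable_wt t : bounded_measurable R (wt mu t).
Proof.
apply: bounded_measurableM; first exact: bounded_measurable_expcos.
exact: bounded_measurable_cst.
Qed.

Lemma wt_gt0 t theta : 0 < wt mu t theta.
Proof. by rewrite divr_gt0 ?expR_gt0// Rintegral_expcos_gt0. Qed.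

Lemma bounded_measurable_wt_sqr t q :
  bounded_measurable R (fun x => wt mu t x * cabs q.[expi x] ^+ 2).
Proof.
apply: bounded_measurableM; first exact: bounded_measurable_wt.
exact: bounded_measurable_sqr_cabs.
Qed.

Lemma exists_ess_supp_seq (n : nat) (eta : R) : ess_supp mu 1 -> 0 < eta ->
  exists s : seq R[i], [/\ uniq s, size s = n &
    forall y, y \in s -> csupp mu y /\ cabs (y - 1) < eta].
Proof.
move=> [_ ess]; elim: n eta => [|n IH] eta eta0; first by exists [::].
have [y sy [y1 ye]] := ess _ eta0.
(* The remaining points are taken strictly closer to 1 than [y], so they differ from it. *)
have [|s [us szs sP]] := IH (cabs (y - 1)).
  by rewrite lt_neqAle cabs_ge0 eq_sym cabs_eq0 subr_eq0 y1.
exists (y :: s); split => /=; last 2 first.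
- by rewrite szs.
- move=> x /predU1P[->//|/sP[sx xy]]; split=> //; exact: lt_trans xy ye.
by rewrite us andbT; apply/negP => /sP[_]; rewrite ltxx.
Qed.

(** The points come first, then [r] from their finitely many distances, then [m] as the least mass
    of the discs, positive because the centres lie in the support. *)
Lemma exists_separated_discs (n : nat) (eta : R) : ess_supp mu 1 -> 0 < eta ->
  exists (s : seq R[i]) (r m : R), [/\ uniq s, size s = n, 0 < r, 0 < m &
    {in s &, forall y z, y != z -> 4 * r <= cabs (y - z)} /\
    forall y, y \in s -> cabs (y - 1) + r < eta /\
      m <= fine (mu [set theta | cabs (expi theta - y) < r])].
Proof.
move=> ess eta0; have [s [us szs sP]] := exists_ess_supp_seq n eta ess eta0.
(* Halving keeps |y - 1| + r < eta strict when r is at most the gap. *)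
pose gap y := (eta - cabs (y - 1)) / 2.
have [|r1 r10 r1P] := seq_positive_min R _ s gap.
  by move=> y /sP[_ yeta]; rewrite divr_gt0// subr_gt0.
(* The value 1 on the diagonal keeps [sep] positive on all pairs. *)
pose sep (yz : R[i] * R[i]) := if yz.1 == yz.2 then 1 else cabs (yz.1 - yz.2).
have [|r2 r20 r2P] := seq_positive_min R _ [seq (y, z) | y <- s, z <- s] sep.
  move=> [y z] _; rewrite /sep /=; case: eqVneq => // yz.
  by rewrite lt_neqAle cabs_ge0 eq_sym cabs_eq0 subr_eq0 yz.
pose r := Num.min r1 (r2 / 4).
have r0 : 0 < r by rewrite lt_min r10 divr_gt0.
have [|m m0 mP] := seq_positive_min R _ s
    (fun y => fine (mu [set theta | cabs (expi theta - y) < r])).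
  move=> y /sP[sy _]; apply: fine_gt0; rewrite (sy _ r0)/=.
  by rewrite -ge0_fin_numE// fin_num_measure//; exact: measurable_disc.
have rr1 : r <= r1 by rewrite ge_min lexx.
have rr2 : r <= r2 / 4 by rewrite ge_min lexx orbT.
exists s, r, m; split => //; split => [y z ys zs yz|y ys].
  have := r2P (y, z); rewrite /sep /= (negbTE yz) => /(_ _) H.
  have := H (allpairs_f pair ys zs); lra.
split; last exact: mP.
have := r1P y ys; have [_ yeta] := sP y ys; rewrite /gap; lra.
Qed.

(** Some disc of positive mass avoids the roots of [q]; on it |q| is at least a fixed positive value
    over K, and the weight is bounded below everywhere. *)
Lemma Rintegral_wt_sqr_gt0 t q : ess_supp mu 1 -> q != 0 ->
  0 < \int[mu]_x (wt mu t x * cabs q.[expi x] ^+ 2).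
Proof.
move=> ess q0.
have [s [r [m [us szs r0 m0 [sep sP]]]]] :=
  exists_separated_discs (size q) 1 ess ltr01.
have szqs : (size q <= size s)%N by rewrite szs.
have [y ys yP] := exists_disc_comparison R s q r r0 us sep q0 szqs.
have [_ my] := sP y ys; set D := [set theta | _] in my.
have [theta0 Dtheta0] := measure_gt0_nonempty D (lt_le_trans m0 my).
set K := (1 + 2 / r) ^+ size s in yP.
have K0 : 0 < K by rewrite exprn_gt0// addr_gt0// divr_gt0.
pose c := expR (- `|2 * t|) / (\int[mu]_x expR (2 * t * cos x)) *
  (cabs q.[expi theta0] / K) ^+ 2.
have c0 : 0 < c.
  rewrite mulr_gt0// ?divr_gt0 ?expR_gt0 ?Rintegral_expcos_gt0// exprn_gt0//.
  rewrite divr_gt0// lt_neqAle cabs_ge0 eq_sym cabs_eq0 andbT.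
  by have [] := yP theta0 _ Dtheta0.
apply: (@lt_le_trans _ _ (c * fine (mu D))).
  by rewrite mulr_gt0// (lt_le_trans m0).
apply: measure_le_Rintegral.
- exact: bounded_measurable_wt_sqr.
- exact: measurable_disc.
- by move=> x; rewrite mulr_ge0 ?sqr_ge0// ltW// wt_gt0.
move=> x Dx; apply: ler_pM.
- by rewrite divr_ge0 ?expR_ge0// ltW// Rintegral_expcos_gt0.
- exact: sqr_ge0.
- by rewrite ler_pM2r ?invr_gt0 ?Rintegral_expcos_gt0// expcos_ge.
rewrite ler_pXn2r// ?nnegrE ?cabs_ge0 ?divr_ge0 ?cabs_ge0 ?(ltW K0)//.
by rewrite ler_pdivrMr// mulrC; have [] := yP theta0 x Dx.
Qed.

(* Where cabs (expi theta - 1) >= d the weight is, up to normalization, at most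
   expR (2 t (1 - d^2/2)), while on a disc at distance d/2 from 1 that is far
   from the roots of q it is at least expR (2 t (1 - d^2/8)). *)
Lemma wt_concentration (n : nat) (d : R) : ess_supp mu 1 -> 0 < d ->
  exists T : R, forall t, T <= t -> forall q, q != 0 -> (size q <= n)%N ->
  exists2 A : R, forall theta,
      wt mu t theta * (cabs (expi theta - 1) * cabs q.[expi theta] ^+ 2) <=
      d * (wt mu t theta * cabs q.[expi theta] ^+ 2) + A
    & A <= d * \int[mu]_x (wt mu t x * cabs q.[expi x] ^+ 2).
Proof.
move=> ess d0; have d20 : 0 < d / 2 by rewrite divr_gt0.
have [s [r [m [us szs r0 m0 [sep sP]]]]] := exists_separated_discs n (d / 2) ess d20.
have [K KE K0] : exists2 K, (1 + 2 / r) ^+ size s = K & 0 < K.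
  by exists ((1 + 2 / r) ^+ size s); rewrite // exprn_gt0// addr_gt0// divr_gt0.
(* The gap 2 (1 - d^2/8) - 2 (1 - d^2/2) between the two exponential rates. *)
pose u : R := 3 / 4 * d ^+ 2.
have u0 : 0 < u by rewrite mulr_gt0// exprn_gt0.
(* For such t, 2 K^4 <= m d (t u), and t u <= exp (t u). *)
exists (2 * K ^+ 4 / (m * d * u)) => t tT q q0 szq.
have t0 : 0 <= t.
  apply: le_trans tT; rewrite divr_ge0 ?mulr_ge0 ?exprn_ge0 ?ltW//.
have szqs : (size q <= size s)%N by rewrite szs.
have [y ys yP] := exists_disc_comparison R s q r r0 us sep q0 szqs.
rewrite KE in yP; have [yd my] := sP y ys; set D := [set theta | _] in my.
have [theta0 Dtheta0] := measure_gt0_nonempty D (lt_le_trans m0 my).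
set Z := \int[mu]_x expR (2 * t * cos x).
have Z0 : 0 < Z by exact: Rintegral_expcos_gt0.
(* [S] bounds |q|^2 on the whole circle. On [D] a second comparison, from [theta0] to x, gives |q|^2
   >= S / K^4. *)
pose S := K ^+ 2 * cabs q.[expi theta0] ^+ 2.
have S0 : 0 <= S by rewrite mulr_ge0 ?sqr_ge0.
have leS theta : cabs q.[expi theta] ^+ 2 <= S.
  rewrite /S -exprMn ler_pXn2r ?nnegrE ?cabs_ge0 ?mulr_ge0 ?cabs_ge0 ?(ltW K0)//.
  by have [] := yP theta theta0 Dtheta0.
have Sle x : D x -> S / K ^+ 4 <= cabs q.[expi x] ^+ 2.
  move=> Dx; rewrite ler_pdivrMr ?exprn_gt0// /S.
  rewrite (_ : _ * K ^+ 4 = K ^+ 2 * (K * cabs q.[expi x]) ^+ 2); last by ring.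
  rewrite ler_wpM2l ?sqr_ge0//.
  rewrite ler_pXn2r ?nnegrE ?cabs_ge0 ?mulr_ge0 ?cabs_ge0 ?(ltW K0)//.
  by have [] := yP theta0 x Dx.
set I := \int[mu]_x (wt mu t x * cabs q.[expi x] ^+ 2).
pose E1 := expR (2 * t * (1 - d ^+ 2 / 2)).
pose E2 := expR (2 * t * (1 - d ^+ 2 / 8)).
have K40 : 0 < K ^+ 4 by rewrite exprn_gt0.
have EZ1 : 0 <= E1 / Z by rewrite divr_ge0 ?expR_ge0 ?ltW.
have EZ2 : 0 <= E2 / Z by rewrite divr_ge0 ?expR_ge0 ?ltW.
have SK : 0 <= S / K ^+ 4 by rewrite divr_ge0// ltW.
have lower : E2 / Z * (S / K ^+ 4) * m <= I.
  apply: (@le_trans _ _ (E2 / Z * (S / K ^+ 4) * fine (mu D))).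
    by rewrite ler_wpM2l// mulr_ge0.
  apply: measure_le_Rintegral.
  - exact: bounded_measurable_wt_sqr.
  - exact: measurable_disc.
  - by move=> x; rewrite mulr_ge0 ?sqr_ge0// ltW// wt_gt0.
  move=> x Dx; apply: ler_pM.
  - exact: EZ2.
  - exact: SK.
  - rewrite ler_pM2r ?invr_gt0// ler_expR ler_wpM2l ?mulr_ge0//.
    have near : cabs (expi x - 1) <= d / 2.
      have := cabs_dist_triangle _ y (expi x) 1; move: Dx yd; rewrite /D /=; lra.
    have : cabs (expi x - 1) ^+ 2 <= (d / 2) ^+ 2.
      by rewrite ler_pXn2r ?nnegrE ?cabs_ge0// ltW.
    rewrite sqr_cabs_expi_sub1; lra.
  - exact: Sle.
(* A bound for the left side away from 1, where |expi theta - 1| <= 2. *)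
exists (2 * (E1 / Z * S)).
  move=> theta; have w0 := ltW (wt_gt0 t theta).
  have wq0 : 0 <= wt mu t theta * cabs q.[expi theta] ^+ 2.
    by rewrite mulr_ge0 ?sqr_ge0.
  rewrite mulrCA; have [near|far] := leP (cabs (expi theta - 1)) d.
    rewrite (le_trans (ler_wpM2r wq0 near))// lerDl.
    by rewrite mulr_ge0// mulr_ge0.
  apply: (@le_trans _ _ (2 * (E1 / Z * S))); last first.
    by rewrite lerDr mulr_ge0// ltW.
  apply: ler_pM => //; first exact: cabs_ge0.
    have := cabs_triangle _ (expi theta) (- 1).
    by rewrite cabsN cabs_expi cabs1.
  apply: ler_pM => //; first exact: sqr_ge0.
  rewrite ler_pM2r ?invr_gt0// ler_expR ler_wpM2l ?mulr_ge0//.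
  have : d ^+ 2 <= cabs (expi theta - 1) ^+ 2.
    by rewrite ler_pXn2r ?nnegrE ?cabs_ge0 ?ltW.
  rewrite sqr_cabs_expi_sub1; lra.
apply: le_trans (ler_wpM2l (ltW d0) lower).
have E12 : E2 = E1 * expR (t * u).
  by rewrite /E1 /E2 -expRD /u; congr expR; field.
have : 2 * K ^+ 4 <= m * d * expR (t * u).
  move: tT; rewrite ler_pdivrMr ?mulr_gt0// => tT.
  have := expR_ge1Dx (t * u) => e1.
  have : m * d * (t * u) <= m * d * expR (t * u).
    by rewrite ler_wpM2l// ?mulr_ge0 ?ltW//; lra.
  by apply: le_trans; rewrite (_ : m * d * (t * u) = t * (m * d * u)) //; ring.
move=> Kle.
(* Multiplying [Kle] by this factor gives the goal. *)
have c0 : 0 <= E1 / Z * (S / K ^+ 4).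
  by rewrite mulr_ge0.
have := ler_wpM2l c0 Kle; congr (_ <= _).
- by field; rewrite ?gt_eqF.
- by rewrite E12; field; rewrite ?gt_eqF.
Qed.

(** The cofactor [q] of a zero varies with t and with the zero; the threshold from
    [wt_concentration] serves all of them at once. *)
Lemma roots_near1 (n : nat) (e : R) : ess_supp mu 1 -> 0 < e ->
  exists T : R, forall t, T <= t -> forall z,
    root (Phi mu (wt mu t) n) z -> cabs (z - 1) < e.
Proof.
move=> ess e0; have d0 : 0 < e / 8 by rewrite divr_gt0.
(* With d = e/8 the estimate reads |z - 1| I <= 2 (d I + A) <= 4 d I = (e/2) I. *)
have [T TP] := wt_concentration n (e / 8) ess d0.
exists T => t tT z rz; have bw := bounded_measurable_wt t.
have OP : is_monic_OP mu (wt mu t) n (Phi mu (wt mu t) n).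
  by apply: is_monic_OP_Phi => // q; exact: Rintegral_wt_sqr_gt0.
have [q [q0 szq] zE] := root_OP R mu (wt mu t) bw n _ z OP rz.
have [|A pointwise Aint] := TP t tT q q0; first by rewrite szq.
have I0 := Rintegral_wt_sqr_gt0 t q ess q0.
set I := \int[mu]_x (wt mu t x * cabs q.[expi x] ^+ 2) in Aint I0.
have := congr1 (@cabs R) zE; rewrite poly_form_self cabsM -/I.
have -> : cabs I%:C%C = I.
  by apply: complexI; rewrite -normc_cabs ger0_norm// ler0c ltW.
move=> cE.
pose g x := e / 8 * (wt mu t x * cabs q.[expi x] ^+ 2) + A.
have bg1 : bounded_measurable R
    (fun x => e / 8 * (wt mu t x * cabs q.[expi x] ^+ 2)).
  apply: bounded_measurableM; first exact: bounded_measurable_cst.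
  exact: bounded_measurable_wt_sqr.
have bg : bounded_measurable R g.
  by apply: bounded_measurableD => //; exact: bounded_measurable_cst.
have : cabs (z - 1) * I <= 2 * \int[mu]_x g x.
  rewrite cE; apply: cabs_cint_le => //.
  - apply: cbounded_measurableM; last exact: cbounded_measurable_conj_mul.
    apply: cbounded_measurableD; last exact: cbounded_measurable_cst.
    exact: cbounded_measurable_expi.
  - by move=> x; rewrite ltW// wt_gt0.
  by move=> x; rewrite !cabsM cabsJ -expr2; exact: pointwise.
rewrite RintegralD_bounded//; last exact: bounded_measurable_cst.
rewrite RintegralZ_bounded; last exact: bounded_measurable_wt_sqr.
rewrite -/I Rintegral_probability_cst => le2.
have : cabs (z - 1) * I < e * I by have := mulr_gt0 e0 I0; lra.
by rewrite ltr_pM2r.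
Qed.

(** The list repeats zeros by multiplicity. The n + 1 signs from the factors - z combine with the
    sign in [alpha] to give (-1)^n. *)
Lemma alpha_prod_roots t (n : nat) : ess_supp mu 1 ->
  exists2 s : seq R[i], size s = n.+1 &
    (forall z, z \in s -> root (Phi mu (wt mu t) n.+1) z) /\
    alpha mu (wt mu t) n = (-1) ^+ n * (\prod_(z <- s) z)^*%C.
Proof.
move=> ess; have bw := bounded_measurable_wt t.
have [monP szP _] : is_monic_OP mu (wt mu t) n.+1 (Phi mu (wt mu t) n.+1).
  by apply: is_monic_OP_Phi => // q; exact: Rintegral_wt_sqr_gt0.
rewrite /alpha; set P := Phi _ _ _ in monP szP *.
have [s PE] := closed_field_poly_normal P.
rewrite (monicP monP) scale1r in PE.
have szs : size s = n.+1.
  by apply/succn_inj; rewrite -szP PE size_prod_XsubC.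
exists s => //; split => [z zs|]; first by rewrite PE root_prod_XsubC.
rewrite PE horner_prod; under eq_bigr do rewrite hornerXsubC add0r -mulN1r.
rewrite big_split /= big_const_seq count_predT szs iter_mulr_1.
rewrite rmorphM rmorphXn rmorphN rmorph1 /= -mulNr; congr (_ * _).
by rewrite exprS mulN1r opprK.
Qed.

End Concentration.

Theorem theorem4p1 (R : realType) (mu : probability R R) :
  mu (~` `[0, 2 * pi[) = 0%E ->
  nontrivial mu ->
  ess_supp mu 1 ->
  (forall (n : nat), (1 <= n)%N ->
     forall e : R, 0 < e -> exists T : R, forall t : R, T <= t ->
       forall z : R[i], root (Phi mu (wt mu t) n) z -> cabs (z - 1) < e) /\
  (forall (n : nat) (e : R), 0 < e -> exists T : R, forall t : R, T <= t ->
       cabs (alpha mu (wt mu t) n - (-1) ^+ n) < e).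
Proof.
move=> _ _ ess; split => [n _ e e0|n e e0]; first exact: roots_near1.
(* [alpha] at n is read off the polynomial of degree n + 1, so n + 1 zeros must be within [d] of
   1. *)
have [d d0 dP] := prod_near1 R n.+1 e e0.
have [T TP] := roots_near1 R mu n.+1 d ess d0.
exists T => t tT.
have [s szs [sroot ->]] := alpha_prod_roots R mu t n ess.
rewrite -[X in _ - X]mulr1 -mulrBr cabsM cabsX cabsN cabs1 expr1n mul1r.
rewrite (_ : _^*%C - 1 = (\prod_(z <- s) z - 1)^*%C); last first.
  by rewrite rmorphB rmorph1.
rewrite cabsJ.
by apply: dP => // z /sroot; exact: TP.
Qed.
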